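(* For every $p\ge1$ and $\mu\ge 1$, the price of estimation satisfies $PoE(\mu,p)=\Theta(\mu\log\tilde D)$. Specifically: (i) for every instance $I$ and every assignment $A$, $\max_t\|\ell(I(\mu),A,t)\|_p=O(\mu\log\tilde D)\cdot\max_t\|\ell(I,A,t)\|_p$; (ii) there exist an instance $I$ and an assignment $A$ for which $\max_t\|\ell(I(\mu),A,t)\|_p=\Omega(\mu\log\tilde D)\cdot\max_t\|\ell(I,A,t)\|_p$.
   Context: An instance $I$ consists of $m$ machines and jobs, where job $j$ has an arrival time $t_j$ (an integer), a duration $d_j\in\{1,\dots,\tilde D\}$ (here there are no estimates, so the maximum duration is denoted $\tilde D$), and loads $p_{ij}\in\mathbb{R}_+\cup\{\infty\}$; job $j$ is alive during the time interval from $t_j$ to $t_j+d_j$. An assignment $A$ maps each job to a machine. $\ell(I,A,t)$ is the load vector at time $t$, whose $i$-th coordinate is the sum of $p_{ij}$ over jobs $j$ with $A(j)=i$ alive at time $t$. $I(\mu)$ denotes the same instance in which every job's duration is replaced by $\mu\cdot d_j$ (same arrival times and loads). The price of estimation is $PoE(\mu,p)=\sup_{(I,A)}\frac{\max_t\|\ell(I(\mu),A,t)\|_p}{\max_t\|\ell(I,A,t)\|_p}$, where $\|x\|_p=(\sum_i x_i^p)^{1/p}$.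
   Formalization: The upper bound is for D̃ ≥ 2 (at D̃ = 1, log D̃ = 0 but the ratio is at least 1); the lower bound is for μ ≥ μ0 with any μ0 > 1 and a constant depending only on μ0, since PoE(1,p) = 1 and no constant is uniform as μ → 1. *)

(* Defs.v *)
From mathcomp Require Import all_boot all_order all_algebra.
From mathcomp Require Import all_classical all_reals all_analysis.

Set Implicit Arguments.
Unset Strict Implicit.
Unset Printing Implicit Defensive.

Import Order.TTheory GRing.Theory Num.Theory.
Local Open Scope classical_set_scope.
Local Open Scope ring_scope.
Local Open Scope ereal_scope.

(* Durations are real here, so that I(mu) is again an instance; the standing
   assumption d_j \in {1, ..., D} is the predicate [durations_upto] below. *)
Record instance (R : realType) := Instance {
  nmachines : nat ;
  njobs : nat ;
  arrival : 'I_njobs -> int ;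
  duration : 'I_njobs -> R ;
  jobload : 'I_nmachines -> 'I_njobs -> \bar R ;
  jobload_ge0 : forall i j, 0 <= jobload i j }.

Definition durations_upto (R : realType) (D : nat) (I : instance R) : Prop :=
  forall j : 'I_(njobs I),
    exists d : nat, (1 <= d <= D)%N /\ duration j = (d%:R)%R.

Definition assignment (R : realType) (I : instance R) : Type :=
  'I_(njobs I) -> 'I_(nmachines I).

Definition stretch (R : realType) (mu : R) (I : instance R) : instance R :=
  @Instance R (nmachines I) (njobs I) (@arrival R I)
    (fun j => mu * duration j)%R (@jobload R I) (@jobload_ge0 R I).

(* A job of duration d occupies [t_j, t_j + d): a unit job is alive at exactly
   one integer time. *)
Definition alive (R : realType) (I : instance R) (t : R) (j : 'I_(njobs I))
  : bool :=
  ((arrival j)%:~R <= t < (arrival j)%:~R + duration j)%R.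

Definition load (R : realType) (I : instance R) (A : assignment I) (t : R)
  (i : 'I_(nmachines I)) : \bar R :=
  \sum_(j < njobs I | (A j == i) && alive t j) jobload i j.

Definition pnorm (R : realType) (p : R) (m : nat) (x : 'I_m -> \bar R)
  : \bar R :=
  (\sum_(i < m) x i `^ p) `^ (p^-1)%R.

(* The supremum over t is a maximum: the load vector takes finitely many
   values.  Ranging over integer times t only would give the same value, since
   arrivals are integers and every job alive at t is alive at floor t. *)
Definition maxload (R : realType) (p : R) (I : instance R) (A : assignment I)
  : \bar R :=
  ereal_sup [set pnorm p (load A t) | t in [set: R]].

Definition positive_finite_maxload (R : realType) (p : R) (I : instance R)
  (A : assignment I) : Prop :=
  0 < maxload p A /\ maxload p A < +oo.

Definition maxload_stretch (R : realType) (mu p : R) (I : instance R)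
  (A : assignment I) : \bar R :=
  @maxload R p (stretch mu I) A.

(* Only pairs (I, A) for which the quotient is meaningful (denominator
   different from 0 and +oo) contribute. *)
Definition PoE (R : realType) (D : nat) (mu p : R) : \bar R :=
  ereal_sup [set r | exists (I : instance R) (A : assignment I),
    [/\ durations_upto D I, positive_finite_maxload p A &
        r = maxload_stretch mu p A / maxload p A]].

(* Main.v *)
Require Import Defs.
From mathcomp Require Import all_boot all_order all_algebra.
From mathcomp Require Import all_classical all_reals all_analysis.
From mathcomp Require Import ring lra.

(** Upper bound: a job alive at [t] in [I(mu)] whose duration lies in
    [[2^k, 2^(k+1))] arrived at distance at most [2^(k+1) mu] before [t], hence
    is alive in [I] at one of the times [t - q 2^k] with [q <= 2 mu].  These are
    [O(mu log D)] times, and the load vector of [I(mu)] at [t] is dominated by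
    the sum of the load vectors of [I] at them, so the triangle inequality for
    the p-norm concludes.

    Lower bound: unit-load jobs on a single machine occupy adjacent intervals,
    going backwards from time [0], each just long enough to survive until [0]
    after stretching.  Then [I] has load at most [1] throughout while all jobs
    of [I(mu)] are alive at [0].  Durations grow at most by the factor
    [mu / (mu - 1)], so about [(mu - 1) ln D] jobs fit before they exceed
    [D]. *)

Set Implicit Arguments.
Unset Strict Implicit.
Unset Printing Implicit Defensive.

Import Order.TTheory GRing.Theory Num.Theory.
Local Open Scope ring_scope.
Local Open Scope ereal_scope.

Lemma poweRK (R : realType) (p : R) (x : \bar R) :
  p != 0%R -> 0 <= x -> (x `^ p) `^ p^-1 = x.
Proof. by move=> p0 x0; rewrite -poweRrM mulfV// poweRe1. Qed.

Section pnorm_order.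
Variables (R : realType) (p : R) (m : nat).
Hypothesis p_gt0 : (0 < p)%R.
Implicit Types x y : 'I_m -> \bar R.

Lemma le_pnorm x y : (forall i, 0 <= x i <= y i) -> pnorm p x <= pnorm p y.
Proof.
move=> xy; have xy_ge0 i : (0 <= x i) * (0 <= y i).
  by have /andP[x0 /(le_trans x0)] := xy i.
apply: gt0_ler_poweR; rewrite ?invr_ge0 ?in_itv/= ?leey ?andbT ?(ltW p_gt0)//.
- by apply: sume_ge0 => i _; exact: poweR_ge0.
- by apply: sume_ge0 => i _; exact: poweR_ge0.
apply: lee_sum => i _; have /andP[_ xyi] := xy i.
by apply: gt0_ler_poweR => //; rewrite ?(ltW p_gt0)// in_itv/= leey xy_ge0.
Qed.

Lemma le_coord_pnorm x i : (forall k, 0 <= x k) -> x i <= pnorm p x.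
Proof.
move=> x0; rewrite -[leLHS](@poweRK _ p)// ?gt_eqF//.
have xp_ge0 k : 0 <= x k `^ p by exact: poweR_ge0.
apply: gt0_ler_poweR; rewrite ?invr_ge0 ?in_itv/= ?leey ?andbT ?(ltW p_gt0)//.
  exact: sume_ge0.
by rewrite (bigD1 i)//= leeDl// sume_ge0.
Qed.

Lemma pnorm_pinfty x i : (forall k, 0 <= x k) -> x i = +oo -> pnorm p x = +oo.
Proof. by move=> x0 xi; apply/eqP; rewrite -leye_eq -xi le_coord_pnorm. Qed.

Lemma pnorm_cst0 : pnorm p (fun _ : 'I_m => 0) = 0.
Proof.
by rewrite /pnorm big1 => [|i _]; apply: poweR0r; rewrite gt_eqF ?invr_gt0.
Qed.

End pnorm_order.

Lemma pnorm_ord1 (R : realType) (p : R) (x : 'I_1 -> \bar R) :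
  p != 0%R -> 0 <= x ord0 -> pnorm p x = x ord0.
Proof. by move=> p0 x0; rewrite /pnorm big_ord1 poweRK. Qed.

Section pnorm_triangle.
Variables (R : realType) (p : R) (m : nat).
Hypothesis p_ge1 : (1 <= p)%R.
Implicit Types x y : 'I_m -> \bar R.

Let p_gt0 : (0 < p)%R. Proof. exact: lt_le_trans p_ge1. Qed.

Definition extend0 (x : 'I_m -> R) (n : nat) : R := oapp x 0%R (insub n).

Lemma pnorm_EFin (x : 'I_m -> R) : (forall i, 0 <= x i)%R ->
  pnorm p (EFin \o x) = 'N[counting]_p%:E[EFin \o extend0 x].
Proof.
move=> x0; rewrite Lnorm_counting// (nneseries_split 0 m); last first.
  by move=> k _; exact: poweR_ge0.
rewrite add0n eseries0 ?adde0 => [|n mn _]; last first.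
  rewrite /= /extend0 insubF ?ltnNge ?mn//= normr0.
  by apply: poweR0r; rewrite gt_eqF.
rewrite big_mkord /pnorm; congr (_ `^ _); apply: eq_bigr => i _.
by rewrite /= /extend0 valK/= ger0_norm.
Qed.

Lemma pnormD_EFin (f g : 'I_m -> R) :
  (forall i, 0 <= f i)%R -> (forall i, 0 <= g i)%R ->
  pnorm p (EFin \o (f \+ g)%R) <= pnorm p (EFin \o f) + pnorm p (EFin \o g).
Proof.
move=> f0 g0; rewrite !pnorm_EFin//; last by move=> i; exact: addr_ge0.
rewrite (_ : extend0 _ = extend0 f \+ extend0 g)%R; first exact: minkowski_EFin.
by apply/funext => n; rewrite /extend0/=; case: insub => //=; rewrite addr0.
Qed.

Lemma pnormD x y : (forall i, 0 <= x i) -> (forall i, 0 <= y i) ->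
  pnorm p (x \+ y) <= pnorm p x + pnorm p y.
Proof.
move=> x0 y0.
have pnorm_neqNy z : pnorm p z != -oo.
  by rewrite gt_eqF// (lt_le_trans _ (poweR_ge0 _ _)).
have [[i [xi|yi]]|fin] := pselect (exists i, x i = +oo \/ y i = +oo).
- by rewrite (pnorm_pinfty p_gt0 x0 xi) addye ?leey.
- by rewrite (pnorm_pinfty p_gt0 y0 yi) addey ?leey.
have fineE (z : 'I_m -> \bar R) : (forall i, 0 <= z i) ->
    (forall i, z i <> +oo) -> z = EFin \o (fine \o z).
  move=> z0 zfin; apply/funext => i /=.
  by rewrite fineK// ge0_fin_numE// ltey; apply/eqP.
rewrite (fineE x)//; last by move=> i xi; apply: fin; exists i; left.
rewrite (fineE y)//; last by move=> i yi; apply: fin; exists i; right.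
by apply: pnormD_EFin => i; exact: fine_ge0.
Qed.

Lemma pnorm_sum (I : Type) (r : seq I) (x : I -> 'I_m -> \bar R) :
  (forall k i, 0 <= x k i) ->
  pnorm p (fun i => \sum_(k <- r) x k i) <= \sum_(k <- r) pnorm p (x k).
Proof.
move=> x0; elim: r => [|k r IHr].
  under eq_fun do rewrite big_nil.
  by rewrite pnorm_cst0// big_nil.
under eq_fun do rewrite big_cons.
rewrite big_cons; apply: (le_trans (pnormD _ _)) => //.
  by move=> i; exact: sume_ge0.
exact: leeD2l.
Qed.

End pnorm_triangle.

Section loads.
Variables (R : realType) (p : R) (I : instance R) (A : assignment I).

Lemma load_ge0 t i : 0 <= load A t i.
Proof. by apply: sume_ge0 => j _; exact: jobload_ge0. Qed.

Lemma pnorm_load_le_maxload t : pnorm p (load A t) <= maxload p A.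
Proof. by apply: ereal_sup_ubound; exists t. Qed.

Lemma maxload_ge0 : 0 <= maxload p A.
Proof. exact: le_trans (poweR_ge0 _ _) (pnorm_load_le_maxload 0%R). Qed.

End loads.

Section stretched_loads.
Variables (R : realType) (mu : R) (I : instance R) (A : assignment I).

Section covering_times.
Variables (T : finType) (t : R) (s : T -> R).
Hypothesis alive_cover : forall j : 'I_(njobs I),
  @alive R (stretch mu I) t j -> exists u, alive (s u) j.

Lemma load_stretch_le_sum i :
  @load R (stretch mu I) A t i <= \sum_u load A (s u) i.
Proof.
rewrite /load; under [leRHS]eq_bigr do rewrite big_mkcond.
rewrite big_mkcond exchange_big/=; apply: lee_sum => j _.
have term_ge0 (b : bool) : 0 <= (if b then jobload i j else 0).
  by case: b => //; exact: jobload_ge0.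
case: ifPn => [/andP[Aj /alive_cover[u uj]]|_]; last exact: sume_ge0.
by rewrite (bigD1 u)//= Aj uj leeDl// sume_ge0.
Qed.

Lemma pnorm_load_stretch_le (p : R) : (1 <= p)%R ->
  pnorm p (@load R (stretch mu I) A t) <= #|T|%:R%:E * maxload p A.
Proof.
move=> p_ge1; have p_gt0 : (0 < p)%R by exact: lt_le_trans p_ge1.
apply: (@le_trans _ _ (pnorm p (fun i => \sum_u load A (s u) i))).
  by apply: le_pnorm => // i; rewrite load_ge0 load_stretch_le_sum.
apply: (le_trans (pnorm_sum p_ge1 _ _)) => [u i|]; first exact: load_ge0.
rewrite (_ : _ * _ = \sum_(u : T) maxload p A).
  by apply: lee_sum => u _; exact: pnorm_load_le_maxload.
by rewrite mule_natl sumr_const.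
Qed.

End covering_times.

Lemma alive_stretch_grid (b w t : R) (j : 'I_(njobs I)) :
  (0 <= mu)%R -> (0 < w)%R -> (w <= duration j <= b * w)%R ->
  @alive R (stretch mu I) t j ->
  exists q : 'I_(Num.truncn (b * mu)%R).+1, alive (t - q%:R * w)%R j.
Proof.
move=> mu_ge0 w_gt0 /andP[w_le le_bw] /andP[/= arr_le lt_end].
set a := (arrival j)%:~R%R in arr_le lt_end.
have age_ge0 : (0 <= (t - a) / w)%R by rewrite divr_ge0 ?subr_ge0// ltW.
have age_le : ((t - a) / w <= b * mu)%R by rewrite ler_pdivrMr//; nra.
have q_lt : (Num.truncn ((t - a) / w)%R < (Num.truncn (b * mu)%R).+1)%N.
  by rewrite ltnS le_truncn.
exists (Ordinal q_lt); rewrite /alive /= -/a.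
have := truncn_itv age_ge0; rewrite ler_pdivlMr// ltr_pdivrMr// -natr1.
set q := _%:R%R => /andP[q_le lt_q].
by apply/andP; split; lra.
Qed.

End stretched_loads.

Section upper_bound.
Variables (R : realType) (D : nat).

Lemma duration_dyadic (I : instance R) (j : 'I_(njobs I)) :
  durations_upto D I ->
  exists k : 'I_(trunc_log 2 D).+1, (2 ^+ k <= duration j <= 2 * 2 ^+ k)%R.
Proof.
move=> /(_ j)[d [/andP[d_ge1 dD] ->]].
have k_lt : (trunc_log 2 d < (trunc_log 2 D).+1)%N.
  by rewrite ltnS leq_trunc_log.
exists (Ordinal k_lt); rewrite -exprS -!natrX !ler_nat /=.
by rewrite trunc_logP// ltnW// trunc_log_ltn.
Qed.

Lemma dyadic_times_card_le (mu : R) : (1 <= mu)%R -> (2 <= D)%N ->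
  (((trunc_log 2 D).+1 * (Num.truncn (2 * mu)%R).+1)%N%:R
   <= 6 / ln 2 * (mu * ln (D%:R : R)))%R.
Proof.
move=> mu_ge1 D_ge2.
have ln2_gt0 : (0 < ln 2 :> R)%R by rewrite ln_gt0// ltr1n.
have D_gt0 : (0 < D%:R :> R)%R by rewrite ltr0n ltnW.
have log_ge1 : (1 <= (trunc_log 2 D)%:R :> R)%R by rewrite ler1n trunc_log_max.
have log_le : ((trunc_log 2 D)%:R <= ln D%:R / ln 2 :> R)%R.
  rewrite ler_pdivlMr// mulrC mulr_natr -lnXn// ler_ln ?posrE ?exprn_gt0//.
  by rewrite -natrX ler_nat trunc_logP// ltnW.
have trunc_le : ((Num.truncn (2 * mu)%R)%:R <= 2 * mu)%R.
  by rewrite truncn_le; lra.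
rewrite natrM -[(trunc_log 2 D).+1%:R]natr1 -[(Num.truncn _).+1%:R]natr1.
have -> : (6 / ln 2 * (mu * ln D%:R)
           = (2 * (ln D%:R / ln 2)) * (3 * mu) :> R)%R.
  by ring.
have trunc_ge0 : (0 <= (Num.truncn (2 * mu)%R)%:R :> R)%R by exact: ler0n.
by apply: ler_pM; lra.
Qed.

Lemma maxload_stretch_le (p mu : R) (I : instance R) (A : assignment I) :
  (1 <= p)%R -> (1 <= mu)%R -> (2 <= D)%N -> durations_upto D I ->
  maxload_stretch mu p A <= (6 / ln 2 * (mu * ln (D%:R : R)))%:E * maxload p A.
Proof.
move=> p_ge1 mu_ge1 D_ge2 ID; apply: ge_ereal_sup => _ [t _ <-].
pose time (u : 'I_(trunc_log 2 D).+1 * 'I_(Num.truncn (2 * mu)%R).+1) :=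
  (t - u.2%:R * 2 ^+ u.1)%R.
have alive_time (j : 'I_(njobs I)) :
    @alive R (stretch mu I) t j -> exists u, alive (time u) j.
  have [k k_dur] := duration_dyadic j ID.
  move=> /(alive_stretch_grid _ _ k_dur)[||q qj].
  - by lra.
  - by rewrite exprn_gt0.
  - by exists (k, q).
apply: (le_trans (pnorm_load_stretch_le A alive_time p_ge1)).
apply: lee_wpmul2r; first exact: maxload_ge0.
by rewrite lee_fin card_prod !card_ord dyadic_times_card_le.
Qed.

End upper_bound.

Section unit_jobs.
Variables (R : realType) (N : nat) (a : 'I_N -> int) (d : 'I_N -> R).

Definition unit_instance : instance R :=
  @Instance R 1 N a d (fun _ _ => 1) (fun _ _ => lee01).

Definition unit_assignment : assignment unit_instance := fun=> ord0.

Lemma pnorm_unit_load (p t : R) : (0 < p)%R ->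
  pnorm p (load unit_assignment t) = #|@alive R unit_instance t|%:R%:E.
Proof.
move=> p_gt0; rewrite pnorm_ord1 ?load_ge0 ?gt_eqF// /load.
by rewrite sumEFin -sumr_const.
Qed.

End unit_jobs.

Arguments unit_assignment {R N} a d _.

Section tiling.
Variables (R : realType) (s : nat -> nat) (N : nat).
Hypothesis s_incr : {homo s : m n / (m < n)%N}.

Definition tiling_arrival (j : 'I_N) : int := (- (s j.+1)%:Z)%R.
Definition tiling_duration (j : 'I_N) : R := (s j.+1 - s j)%:R%R.

Definition tiling_instance := unit_instance tiling_arrival tiling_duration.
Definition tiling_assignment := unit_assignment tiling_arrival tiling_duration.

Lemma tiling_aliveE t (j : 'I_N) : @alive R tiling_instance t j =
  (- (s j.+1)%:R <= t < - (s j)%:R)%R.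
Proof.
rewrite /alive /= mulrNz -pmulrn /tiling_duration natrB; last first.
  by rewrite ltnW// s_incr.
by rewrite addrA addNr add0r.
Qed.

Lemma tiling_alive_card_le1 t : (#|@alive R tiling_instance t| <= 1)%N.
Proof.
have disjoint (i j : 'I_N) : @alive R tiling_instance t i ->
    @alive R tiling_instance t j -> ~ (i < j)%N.
  rewrite !tiling_aliveE => /andP[le_t _] /andP[_ t_lt] ij.
  have : ((s i.+1)%:R <= (s j)%:R :> R)%R by rewrite ler_nat ltnW_homo.
  by lra.
apply/card_le1_eqP => i j it jt; apply/val_inj.
by case: (ltngtP i j) => // /disjoint; [case/(_ it jt)|case/(_ jt it)].
Qed.

Lemma tiling_maxload (p : R) : (0 < p)%R -> (0 < N)%N ->
  maxload p tiling_assignment = 1.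
Proof.
move=> p_gt0 N_gt0; apply/eqP; rewrite eq_le; apply/andP; split.
  apply: ge_ereal_sup => _ [t _ <-].
  by rewrite pnorm_unit_load// lee_fin lern1 tiling_alive_card_le1.
apply: le_trans (pnorm_load_le_maxload _ _ (- (s 1)%:R)%R).
rewrite pnorm_unit_load// lee_fin ler1n; apply/card_gt0P.
exists (Ordinal N_gt0); rewrite -topredE /= tiling_aliveE lexx /=.
by rewrite ltrN2 ltr_nat s_incr.
Qed.

Lemma tiling_maxload_stretch_ge (p mu : R) : (0 < p)%R ->
  (forall j, (j < N)%N -> (s j.+1)%:R < mu * (s j.+1 - s j)%:R)%R ->
  N%:R%:E <= maxload_stretch mu p tiling_assignment.
Proof.
move=> p_gt0 survive.
apply: le_trans (pnorm_load_le_maxload _ _ 0%R).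
have alive0 j : @alive R (stretch mu tiling_instance) 0%R j.
  have := survive j (ltn_ord j); have := ler0n R (s j.+1).
  rewrite /alive /= mulrNz -pmulrn /tiling_duration.
  by move=> *; apply/andP; split; lra.
rewrite (@pnorm_unit_load _ _ _ (fun j => mu * tiling_duration j)%R)//.
by rewrite (eq_card (B := 'I_N)) ?card_ord// => j; rewrite -topredE /= alive0.
Qed.

End tiling.

Arguments tiling_assignment R s N _ : clear implicits.

Section greedy_tiling.
Variables (R : realType) (mu : R).
Hypothesis mu_gt1 : (1 < mu)%R.

(* The least [d] with [s + d < mu * d]. *)
Definition greedy_duration (s : nat) : nat :=
  (Num.truncn (s%:R / (mu - 1))%R).+1.

Definition greedy_tiling (n : nat) : nat :=
  iter n (fun s => s + greedy_duration s)%N 0%N.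

Let nu_gt0 : (0 < mu - 1)%R. Proof. by rewrite subr_gt0. Qed.

Lemma greedy_tilingS n : greedy_tiling n.+1 =
  (greedy_tiling n + greedy_duration (greedy_tiling n))%N.
Proof. by []. Qed.

Lemma greedy_tiling_incr : {homo greedy_tiling : m n / (m < n)%N}.
Proof.
apply: homo_ltn => [|n]; first exact: ltn_trans.
by rewrite greedy_tilingS addnS ltnS leq_addr.
Qed.

Lemma greedy_duration_survives s :
  ((s + greedy_duration s)%:R < mu * (greedy_duration s)%:R)%R.
Proof.
have := truncnS_gt (s%:R / (mu - 1))%R.
by rewrite -/(greedy_duration s) ltr_pdivrMr// natrD; lra.
Qed.

Lemma greedy_duration_le s : ((greedy_duration s)%:R <= s%:R / (mu - 1) + 1)%R.
Proof. by rewrite -natr1 lerD2r truncn_le divr_ge0// ltW. Qed.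

Lemma greedy_tiling_le_geometric n :
  ((greedy_tiling n)%:R / (mu - 1) + 1 <= (1 + (mu - 1)^-1) ^+ n)%R.
Proof.
elim: n => [|n IHn]; first by rewrite expr0 mul0r add0r.
rewrite greedy_tilingS natrD exprS mulrDl.
set s := greedy_tiling n in IHn *; set v := ((mu - 1)^-1)%R in IHn *.
have v_ge0 : (0 <= v)%R by rewrite invr_ge0 ltW.
have d_le := ler_wpM2r v_ge0 (greedy_duration_le s); rewrite -/v in d_le.
apply: le_trans (ler_wpM2l _ IHn); last by rewrite addr_ge0.
by lra.
Qed.

Lemma greedy_duration_le_expR n :
  ((greedy_duration (greedy_tiling n))%:R <= expR (n%:R / (mu - 1)))%R.
Proof.
apply: (le_trans (greedy_duration_le _)).
apply: (le_trans (greedy_tiling_le_geometric n)).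
rewrite mulrC expRM_natr lerXn2r ?nnegrE ?expR_ge0 ?expR_ge1Dx//.
by rewrite addr_ge0// invr_ge0 ltW.
Qed.

End greedy_tiling.

Lemma exists_maxload_stretch_ge (R : realType) (p mu : R) (D : nat) :
  (1 <= p)%R -> (1 < mu)%R -> (1 <= D)%N ->
  exists (I : instance R) (A : assignment I),
    [/\ durations_upto D I, positive_finite_maxload p A &
        ((mu - 1) * ln (D%:R : R))%:E * maxload p A <= maxload_stretch mu p A].
Proof.
move=> p_ge1 mu_gt1 D_ge1; have p_gt0 : (0 < p)%R by exact: lt_le_trans p_ge1.
have nu_gt0 : (0 < mu - 1)%R by rewrite subr_gt0.
set L := ((mu - 1) * ln D%:R)%R.
have L_ge0 : (0 <= L)%R by rewrite mulr_ge0 ?ln_ge0 ?ler1n// ltW.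
have incr := greedy_tiling_incr mu.
pose A := tiling_assignment R (greedy_tiling mu) (Num.truncn L).+1.
have maxload_A : maxload p A = 1 by exact: tiling_maxload.
exists (tiling_instance R (greedy_tiling mu) (Num.truncn L).+1), A; split.
- move=> j; exists (greedy_duration mu (greedy_tiling mu j)); split; last first.
    by rewrite /= /tiling_duration greedy_tilingS addKn.
  rewrite /= -(ler_nat R); apply: (le_trans (greedy_duration_le_expR mu_gt1 j)).
  rewrite -[leRHS]lnK ?posrE ?ltr0n// ler_expR ler_pdivrMr// [leRHS]mulrC.
  by rewrite -truncn_ge_nat// -ltnS.
- by rewrite /positive_finite_maxload maxload_A lte01 ltry.
- rewrite maxload_A mule1; apply: (@le_trans _ _ (Num.truncn L).+1%:R%:E).
    by rewrite lee_fin ltW// truncnS_gt.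
  apply: tiling_maxload_stretch_ge => // j _.
  by rewrite greedy_tilingS addKn greedy_duration_survives.
Qed.

Section ratio.
Variables (R : realType) (x y c : \bar R).
Hypotheses (y_gt0 : 0 < y) (y_ltey : y < +oo).

Lemma lee_edivlMr : (c <= x / y) = (c * y <= x).
Proof.
case: y y_gt0 y_ltey => [r| |]//; rewrite lte_fin => r_gt0 _.
by rewrite inver gt_eqF// lee_pdivlMr.
Qed.

Lemma lee_edivrMr : (x / y <= c) = (x <= c * y).
Proof.
case: y y_gt0 y_ltey => [r| |]//; rewrite lte_fin => r_gt0 _.
by rewrite inver gt_eqF// lee_pdivrMr.
Qed.

End ratio.

Section price_of_estimation.
Variables (R : realType) (D : nat) (mu p : R) (c : \bar R).

Lemma PoE_le :
  (forall (I : instance R) (A : assignment I), durations_upto D I ->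
    maxload_stretch mu p A <= c * maxload p A) ->
  PoE D mu p <= c.
Proof.
move=> le_c; apply: ge_ereal_sup => _ [I [A [ID [gt0 lty] ->]]].
by rewrite lee_edivrMr// le_c.
Qed.

Lemma PoE_ge (I : instance R) (A : assignment I) :
  durations_upto D I -> positive_finite_maxload p A ->
  c * maxload p A <= maxload_stretch mu p A -> c <= PoE D mu p.
Proof.
move=> ID [gt0 lty]; rewrite -lee_edivlMr// => /le_trans; apply.
by apply: ereal_sup_ubound; exists I, A.
Qed.

End price_of_estimation.

Theorem theorem3 (R : realType) :
  (exists C : R, (0 < C)%R /\
    forall (p mu : R) (D : nat), (1 <= p)%R -> (1 <= mu)%R -> (2 <= D)%N ->
      PoE D mu p <= (C * (mu * ln (D%:R : R)))%:E /\
      forall (I : instance R) (A : assignment I), durations_upto D I ->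
        maxload_stretch mu p A
          <= (C * (mu * ln (D%:R : R)))%:E * maxload p A)
  /\
  (forall mu0 : R, (1 < mu0)%R ->
   exists c : R, (0 < c)%R /\
    forall (p mu : R) (D : nat), (1 <= p)%R -> (mu0 <= mu)%R -> (1 <= D)%N ->
      (c * (mu * ln (D%:R : R)))%:E <= PoE D mu p /\
      exists (I : instance R) (A : assignment I),
        [/\ durations_upto D I, positive_finite_maxload p A &
            (c * (mu * ln (D%:R : R)))%:E * maxload p A
              <= maxload_stretch mu p A]).
Proof.
split=> [|mu0 mu0_gt1].
  exists (6 / ln 2)%R; split; first by rewrite divr_gt0// ln_gt0// ltr1n.
  move=> p mu D p_ge1 mu_ge1 D_ge2.
  by split; [apply: PoE_le|] => I A; exact: maxload_stretch_le.
have mu0_gt0 : (0 < mu0)%R by exact: lt_trans mu0_gt1.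
exists (1 - mu0^-1)%R; split; first by rewrite subr_gt0 invf_lt1.
move=> p mu D p_ge1 mu0_le D_ge1.
have mu_gt1 : (1 < mu)%R by exact: lt_le_trans mu0_le.
have mu_le : ((1 - mu0^-1) * mu <= mu - 1)%R.
  by rewrite mulrBl mul1r lerB// ler_pdivlMl// mulr1.
have [I [A [ID IA_pos IA_ge]]] := exists_maxload_stretch_ge p_ge1 mu_gt1 D_ge1.
have ge : ((1 - mu0^-1) * (mu * ln (D%:R : R)))%:E * maxload p A
    <= maxload_stretch mu p A.
  apply: le_trans IA_ge; apply: lee_wpmul2r; first exact: maxload_ge0.
  by rewrite lee_fin mulrA ler_wpM2r// ln_ge0// ler1n.
by split; [exact: PoE_ge ge|exists I, A].
Qed.
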